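(* There exist a prime $p$, a field $k$ of characteristic $p$, a finite group $G$, and a finitely generated $kG$-module $M$ with $V_G(M)=V_G(k)$ such that $\hat H^*(G,M)$ is not finitely generated as a graded module over $\hat H^*(G,k)$.
   Context: $\hat H^n(G,M)\cong\underline{\operatorname{Hom}}_{kG}(\Omega^n k,M)$, $n\in\mathbb Z$, is Tate cohomology; $\hat H^*(G,M)=\bigoplus_{n\in\mathbb Z}\hat H^n(G,M)$ is a graded module over the Tate cohomology ring $\hat H^*(G,k)$ via cup product. $V_G(k)$ is the maximal ideal spectrum of the ordinary cohomology ring $H^*(G,k)$; the support variety $V_G(M)\subseteq V_G(k)$ is the closed set of maximal ideals containing the annihilator in $H^*(G,k)$ of $\operatorname{Ext}^*_{kG}(M,M)$. *)

(* Defs.v *)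
From HB Require Import structures.
From mathcomp Require Import all_boot all_order all_algebra all_fingroup all_character.
From mathcomp Require Import boolp classical_sets functions.

Set Implicit Arguments.
Unset Strict Implicit.
Unset Printing Implicit Defensive.

Import Order.TTheory GRing.Theory Num.Theory.
Local Open Scope classical_set_scope.
Local Open Scope ring_scope.

(* The finite group G is the whole of gT.  A finitely generated kG-module is a
   representation of G over k, acting on the right on row vectors.
   All cohomology is computed from the standard complete resolution P of k:
   - P_n, for n >= 0, has k-basis the (n+1)-tuples (g_0, ..., g_n);
   - P_(-n), for n >= 1, is the dual of P_(n-1), with dual basis the n-tuples
     (g_1*, ..., g_n* );
   - G acts by translating all the entries of a tuple.
   A homogeneous cochain, i.e., a kG-linear map from P_n to a coefficient
   module V, is encoded by an equivariant function seq gT -> V that vanishes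
   on the sequences of the wrong size.  For n >= 0 sizes determine degrees, so
   finite sums of cochains of nonnegative degrees are also just functions
   seq gT -> V. *)

Section Coefficients.
Variables (k : fieldType) (gT : finGroupType).

Definition equivariant (V : lmodType k) (act : V -> gT -> V)
    (f : seq gT -> V) : Prop :=
  forall (x : gT) (s : seq gT), f [seq (y * x)%g | y <- s] = act (f s) x.

Definition triv_act (v : k^o) (_ : gT) : k^o := v.

Definition mod_act m (rG : mx_representation k [set: gT]%G m)
    (v : 'rV[k]_m) (x : gT) : 'rV[k]_m := v *m rG x.

(* The conjugation action on End_k(M). *)
Definition end_act m (rG : mx_representation k [set: gT]%G m)
    (A : 'M[k]_m) (x : gT) : 'M[k]_m := rG x^-1%g *m A *m rG x.

End Coefficients.

Arguments triv_act {k gT} v _.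

Section StandardComplex.
Variables (k : fieldType) (gT : finGroupType) (V : lmodType k).
Implicit Types (f : seq gT -> V) (s : seq gT).

Definition face (i : nat) s : seq gT := take i s ++ drop i.+1 s.

Definition insertion (i : nat) (x : gT) s : seq gT := take i s ++ x :: drop i s.

Definition diff f : seq gT -> V :=
  fun s => \sum_(i < size s) (-1) ^+ i *: f (face i s).

(* Number of entries in the basis elements of P_n; Negz m is -(m+1). *)
Definition tate_size (n : int) : nat :=
  match n with Posz m => m.+1 | Negz m => m.+1 end.

(* The map from degree n to degree n + 1.  It is dual to the boundary of P:
   P_0 -> P_(-1) maps (g_0) to \sum_x (x* ), and P_(-q) -> P_(-q-1) maps
   (g_1*, ..., g_q* ) to \sum_x \sum_i (-1)^i (g_1*, .., g_i*, x*, .., g_q* ). *)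
Definition tate_diff (n : int) f : seq gT -> V :=
  match n with
  | Posz _ => diff f
  | Negz 0 => fun s => if size s == 1%N then \sum_(x : gT) f [:: x] else 0
  | Negz _.+1 => fun s =>
      \sum_(x : gT) \sum_(i < (size s).+1) (-1) ^+ i *: f (insertion i x s)
  end.

End StandardComplex.

Section CupProduct.
Variables (k : fieldType) (gT : finGroupType) (V : lmodType k).
Implicit Types (a : seq gT -> k) (f : seq gT -> V) (s : seq gT).

(* The Alexander-Whitney cup product, on sums of cochains of nonnegative
   degrees. *)
Definition cup a f : seq gT -> V :=
  fun s => \sum_(i < size s) a (take i.+1 s) *: f (drop i s).

(* The cup product of a in degree p and f in degree q, for the diagonal
   approximation P_(p+q) -> P_p (x) P_q on the standard complete resolution
   given by Atiyah and Wall (Cassels-Frohlich, chapter IV, section 7):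
   for degrees of opposite signs the missing entries t are summed over. *)
Definition tate_cup (p q : int) a f : seq gT -> V :=
  match p, q with
  | Posz i, Posz j => fun s => a (take i.+1 s) *: f (drop i s)
  | Negz i, Negz j => fun s => a (take i.+1 s) *: f (drop i.+1 s)
  | Posz i, Negz j =>
      if (i < j.+1)%N then fun s =>
        \sum_(t : i.-tuple gT) a (take 1 s ++ t) *: f (rev t ++ s)
      else fun s =>
        \sum_(t : j.+1.-tuple gT) a (s ++ t) *: f (rev t)
  | Negz i, Posz j =>
      if (j < i.+1)%N then fun s =>
        \sum_(t : j.-tuple gT) a (s ++ t) *: f (rev t ++ drop (size s).-1 s)
      else fun s =>
        \sum_(t : i.+1.-tuple gT) a t *: f (rev t ++ s)
  end.

End CupProduct.

Section Cohomology.
Variables (k : fieldType) (gT : finGroupType).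
Variables (V : lmodType k) (act : V -> gT -> V).

(* H^*(G, V) = \bigoplus_(n >= 0) H^n(G, V) is cocycle / coboundary. *)
Definition cochain : set (seq gT -> V) :=
  [set f | [/\ f [::] = 0, equivariant act f
             & exists N : nat, forall s, (N < size s)%N -> f s = 0]].

Definition cocycle : set (seq gT -> V) :=
  [set f | cochain f /\ diff f = 0].

Definition coboundary : set (seq gT -> V) :=
  [set diff h | h in cochain].

(* The Tate cohomology group of degree n is
   tate_cocycle n / tate_coboundary n.  Writing Omega^n k for the image of
   P_n -> P_(n-1), this is the quotient of Hom_kG(Omega^n k, V) by the maps
   that factor through a projective, i.e., that extend to P_(n-1). *)
Definition tate_cochain (n : int) : set (seq gT -> V) :=
  [set f | equivariant act f /\ forall s, size s != tate_size n -> f s = 0].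

Definition tate_cocycle (n : int) : set (seq gT -> V) :=
  [set f | tate_cochain n f /\ tate_diff n f = 0].

Definition tate_coboundary (n : int) : set (seq gT -> V) :=
  [set tate_diff (n - 1) h | h in tate_cochain (n - 1)].

End Cohomology.

Section SupportVariety.
Variables (k : fieldType) (gT : finGroupType).

(* The ideals of H^*(G, k), as sets of cocycles that are unions of cohomology
   classes.  They need not be homogeneous; closure under opposites follows
   from that under multiplication by the degree 0 cocycle -1. *)
Definition coh_ideal (I : set (seq gT -> k^o)) : Prop :=
  [/\ coboundary triv_act `<=` I,
      I `<=` cocycle triv_act,
      forall z w, I z -> I w -> I (z + w)
    & forall z w, cocycle triv_act z -> I w ->
        I (@cup k gT k^o z w) /\ I (@cup k gT k^o w z)].

(* V_G(k) *)
Definition max_ideal_spectrum : set (set (seq gT -> k^o)) :=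
  [set I | [/\ coh_ideal I, I <> cocycle triv_act
             & forall J, coh_ideal J -> I `<=` J ->
                 J = I \/ J = cocycle triv_act]].

(* Ext^*_kG(M, M) is the cohomology of Hom_kG(P (x) M, M), where P (x) M is a
   projective resolution of M (P being truncated to nonnegative degrees), and
   this complex is Hom_kG(P, End_k(M)). *)
Definition ext_annihilator m (rG : mx_representation k [set: gT]%G m) :
    set (seq gT -> k^o) :=
  [set z | cocycle triv_act z /\
     forall f, cocycle (end_act rG) f -> coboundary (end_act rG) (@cup k _ _ z f)].

(* V_G(M) *)
Definition support_variety m (rG : mx_representation k [set: gT]%G m) :
    set (set (seq gT -> k^o)) :=
  [set I | max_ideal_spectrum I /\ ext_annihilator rG `<=` I].

End SupportVariety.

Arguments max_ideal_spectrum : clear implicits.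

(* Tate cohomology with coefficients in M is generated, as a graded module over
   Tate cohomology with coefficients in k, by finitely many classes x i,
   homogeneous of degrees e i. *)
Definition tate_finitely_generated (k : fieldType) (gT : finGroupType) m
    (rG : mx_representation k [set: gT]%G m) : Prop :=
  exists (r : nat) (e : 'I_r -> int) (x : 'I_r -> seq gT -> 'rV[k]_m),
    (forall i, tate_cocycle (mod_act rG) (e i) (x i)) /\
    forall (n : int) (y : seq gT -> 'rV[k]_m),
      tate_cocycle (mod_act rG) n y ->
      exists a : 'I_r -> seq gT -> k^o,
        (forall i, tate_cocycle triv_act (n - e i) (a i)) /\
        tate_coboundary (mod_act rG) n
          (y - \sum_(i < r) @tate_cup k _ _ (n - e i) (e i) (a i) (x i)).

(* Main.v *)
(* Let k have characteristic 2, G = H x K with H, K of order 2, N = k[G/H] and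
   M = k (+) N.  A class annihilating Ext^*(M, M) kills the identity of the
   summand k, so it is zero and V_G(M) = V_G(k).  By Shapiro's lemma the Tate
   cohomology of N is that of H, which is nonzero in every degree, while
   restriction from G to H vanishes in negative degrees.  Hence, in a degree
   below those of finitely many given classes, all the classes that they
   generate have zero component in N.
   On cochains, Shapiro's isomorphism takes a coordinate of N, which is an
   H-invariant function f on tuples of G.  In degree -q its class is detected
   by the sum of f over the q-tuples whose images in H alternate.  This sum
   vanishes on boundaries of H-invariant functions, and on K-invariant
   functions, since K permutes freely the tuples of the sum.  That settles the
   products with a class of negative degree; for those with a cocycle x of
   degree >= 0, a prism homotopy first replaces x by its pullback along the
   projection of G onto H. *)
Require Import Defs.
From mathcomp Require Import all_boot all_order all_algebra all_fingroup all_character.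
From mathcomp Require Import boolp classical_sets functions.
From mathcomp Require Import ring zify.
Import GRing.Theory.

Set Implicit Arguments.
Unset Strict Implicit.
Unset Printing Implicit Defensive.

Local Open Scope ring_scope.

(** * Boundary and coboundary on functions of tuples *)

Section Sequences.
Variables (k : fieldType) (gT : finGroupType).
Implicit Types (a c f h : seq gT -> k) (s t : seq gT) (x y z g : gT).

Definition cobdry f : seq gT -> k := @diff k gT k^o f.

(** All degrees below -1 share one formula, so [Negz 1] stands for any of them. *)
Definition bdry f : seq gT -> k := @tate_diff k gT k^o (Negz 1) f.

Lemma cobdry_nil f : cobdry f [::] = 0.
Proof. by rewrite /cobdry /diff big_ord0. Qed.

Lemma cobdry_cons f x s : cobdry f (x :: s) = f s - cobdry (fun t => f (x :: t)) s.
Proof.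
rewrite /cobdry /diff big_ord_recl /= expr0 scale1r /face /= drop0; congr (_ + _).
rewrite -sumrN; apply: eq_bigr => i _.
by rewrite /bump /= add1n exprS mulN1r scaleNr.
Qed.

Lemma bdry_nil f : bdry f [::] = \sum_x f [:: x].
Proof. by apply: eq_bigr => x _; rewrite big_ord1 expr0 scale1r. Qed.

Lemma bdry_cons f y s :
  bdry f (y :: s) = \sum_x f [:: x, y & s] - bdry (fun t => f (y :: t)) s.
Proof.
rewrite /bdry /= -sumrB; apply: eq_bigr => x _.
rewrite big_ord_recl /= expr0 scale1r /insertion /= -sumrN; congr (_ + _).
by apply: eq_bigr => i _; rewrite /bump /= add1n exprS mulN1r scaleNr.
Qed.

Lemma eq_bdry f h s :
  (forall t, size t = (size s).+1 -> f t = h t) -> bdry f s = bdry h s.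
Proof.
move=> efh; apply: eq_bigr => x _; apply: eq_bigr => i _; rewrite efh //.
by rewrite /insertion size_cat /= addnS -size_cat cat_take_drop.
Qed.

Fixpoint sum_seq n (f : seq gT -> k) : k :=
  if n is m.+1 then \sum_x sum_seq m (fun s => f (x :: s)) else f [::].

Lemma sum_seqS n f :
  sum_seq n.+1 f = \sum_x sum_seq n (fun s => f (x :: s)).
Proof. by []. Qed.

Lemma eq_sum_seq n f h : (forall s, f s = h s) -> sum_seq n f = sum_seq n h.
Proof.
elim: n f h => [|n IH] f h e /=; first exact: e.
by apply: eq_bigr => x _; apply: IH.
Qed.

Lemma sum_tuple n f : \sum_(t : n.-tuple gT) f t = sum_seq n f.
Proof.
elim: n f => [|n IH] f /=.
  by rewrite (big_pred1 [tuple]) // => t; apply/esym/eqP/val_inj; case: t => -[].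
under [RHS]eq_bigr do rewrite -IH.
rewrite pair_bigA (reindex (fun p : gT * n.-tuple gT => cons_tuple p.1 p.2)) //=.
exists (fun u : n.+1.-tuple gT => (thead u, [tuple of behead u]))
  => [[x u] _|u _] /=; last by rewrite [RHS]tuple_eta; apply: val_inj.
by congr (_, _); apply: val_inj.
Qed.

Lemma sum_seqD n f h : sum_seq n (fun s => f s + h s) = sum_seq n f + sum_seq n h.
Proof.
elim: n f h => //= n IH f h.
by under eq_bigr do rewrite IH; rewrite big_split.
Qed.

Lemma sum_seqN n f : sum_seq n (fun s => - f s) = - sum_seq n f.
Proof.
elim: n f => //= n IH f.
by under eq_bigr do rewrite IH; rewrite sumrN.
Qed.

Lemma sum_seq_sum n (F : gT -> seq gT -> k) :
  sum_seq n (fun s => \sum_x F x s) = \sum_x sum_seq n (F x).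
Proof.
elim: n F => //= n IH F.
by under eq_bigr do rewrite (IH (fun x s => F x (_ :: s))); rewrite exchange_big.
Qed.

Lemma sum_seq_translate n f g :
  sum_seq n (fun s => f [seq (y * g)%g | y <- s]) = sum_seq n f.
Proof.
elim: n f => //= n IH f.
under eq_bigr do rewrite (IH (fun s => f (_ :: s))).
by rewrite [RHS](reindex_inj (mulIg g)).
Qed.

(** Deleting the entry of index [i] undoes inserting one there, and both carry the sign
    [(-1) ^+ i]. *)
Lemma sum_seq_adjoint n a c :
  sum_seq n.+1 (fun t => a t * cobdry c t) = sum_seq n (fun t => bdry a t * c t).
Proof.
elim: n a c => [|n IH] a c.
  rewrite /= bdry_nil mulr_suml; apply: eq_bigr => x _.
  by rewrite cobdry_cons cobdry_nil subr0.
transitivity (\sum_x sum_seq n.+1 (fun t => a (x :: t) * c t)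
   - \sum_x sum_seq n.+1 (fun t => a (x :: t) * cobdry (fun u => c (x :: u)) t)).
  rewrite [LHS]sum_seqS -sumrB; apply: eq_bigr => x _.
  rewrite -sum_seqN -sum_seqD; apply: eq_sum_seq => t.
  by rewrite cobdry_cons mulrBr.
under [X in _ - X]eq_bigr do rewrite (IH (fun t => a (_ :: t))).
rewrite -sum_seq_sum /= -sumrB; apply: eq_bigr => y _.
rewrite -sum_seqN -sum_seqD; apply: eq_sum_seq => t.
by rewrite bdry_cons mulrBl; congr (_ - _); rewrite mulr_suml.
Qed.

(** * The prism homotopy from the identity to a self-map of the group *)

Section Prism.
Variable r : gT -> gT.

Fixpoint prism f s : k :=
  if s is x :: s' then
    f [:: x, r x & map r s'] - prism (fun t => f (x :: t)) s'
  else 0.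

Lemma prismB f h s : prism (fun t => f t - h t) s = prism f s - prism h s.
Proof.
elim: s f h => [|x s IH] f h /=; first by rewrite subr0.
by rewrite IH; ring.
Qed.

Lemma eq_prism f h s : (forall t, f t = h t) -> prism f s = prism h s.
Proof.
elim: s f h => //= x s IH f h e; congr (_ - _); first exact: e.
exact: IH.
Qed.

Lemma cobdryB f h s : cobdry (fun t => f t - h t) s = cobdry f s - cobdry h s.
Proof.
rewrite /cobdry /diff -sumrB; apply: eq_bigr => i _; exact: mulrBr.
Qed.

Lemma cobdry_map f s : cobdry (fun t => f (map r t)) s = cobdry f (map r s).
Proof.
rewrite /cobdry /diff size_map; apply: eq_bigr => i _.
by rewrite /face map_cat map_take map_drop.
Qed.

Lemma prism_homotopy f s :
  cobdry (prism f) s + prism (cobdry f) s = f (map r s) - f s.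
Proof.
elim: s f => [|x s IH] f; first by rewrite cobdry_nil /= addr0 subrr.
rewrite cobdry_cons [prism _ (x :: s)]/= !cobdry_cons.
rewrite (cobdryB (fun t => f [:: x, r x & map r t]) (prism (fun t => f (x :: t)))).
rewrite (eq_prism s (cobdry_cons f x)) prismB.
rewrite (cobdry_map (fun t => f [:: x, r x & t])) /=.
have /(canRL (addrK _)) -> := IH (fun t => f (x :: t)); ring.
Qed.

Lemma prism_translate f g :
    (forall x, r (x * g)%g = (r x * g)%g) ->
    (forall s, f [seq (y * g)%g | y <- s] = f s) ->
  forall s, prism f [seq (y * g)%g | y <- s] = prism f s.
Proof.
move=> rg fg s.
have -> : prism f s = prism (fun t => f [seq (y * g)%g | y <- t]) s.
  exact: eq_prism.
elim: s {fg} f => //= x s IH f; rewrite rg; congr (f [:: _, _ & _] - _); last exact: IH.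
by rewrite -!map_comp; apply: eq_map => y /=.
Qed.

End Prism.

(** * Products of negative and nonnegative degrees, and their Leibniz rule *)

(* The cup product of a in negative degree and c in degree m, without the
   reversal of the entries of c. *)
Fixpoint cap m a c s : k :=
  if s is z :: s' then
    if s' is [::] then sum_seq m (fun t => a (z :: t) * c (z :: t))
    else cap m (fun t => a (z :: t)) c s'
  else 0.

Lemma eq_cap m a a' c c' s :
  (forall t, a t = a' t) -> (forall t, c t = c' t) -> cap m a c s = cap m a' c' s.
Proof.
elim: s a a' => //= z [|y s] IH a a' ea ec; last exact: IH.
by apply: eq_sum_seq => t; rewrite ea ec.
Qed.

Lemma capDl m a a' c s :
  cap m (fun t => a t + a' t) c s = cap m a c s + cap m a' c s.
Proof.
elim: s a a' => [|z [|y s] IH] a a'; [by rewrite addr0| |exact: IH].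
by rewrite /= -sum_seqD; apply: eq_sum_seq => t; rewrite mulrDl.
Qed.

Lemma cap0l m c s : cap m (fun=> 0) c s = 0.
Proof.
apply: (addrI (cap m (fun=> 0) c s)); rewrite -capDl [RHS]addr0.
by apply: eq_cap => // t; rewrite addr0.
Qed.

Lemma capNl m a c s : cap m (fun t => - a t) c s = - cap m a c s.
Proof.
elim: s a => [|z [|y s] IH] a; [by rewrite oppr0| |exact: IH].
by rewrite /= -sum_seqN; apply: eq_sum_seq => t; rewrite mulNr.
Qed.

Lemma cap_suml m (a : gT -> seq gT -> k) c s :
  cap m (fun t => \sum_x a x t) c s = \sum_x cap m (a x) c s.
Proof.
elim: s a => [|z [|y s] IH] a.
- by rewrite big1.
- by rewrite /= -sum_seq_sum; apply: eq_sum_seq => t; rewrite mulr_suml.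
- exact: (IH (fun x t => a x (z :: t))).
Qed.

Lemma capDr m a c c' s :
  cap m a (fun t => c t + c' t) s = cap m a c s + cap m a c' s.
Proof.
elim: s a => [|z [|y s] IH] a; [by rewrite addr0| |exact: IH].
by rewrite /= -sum_seqD; apply: eq_sum_seq => t; rewrite mulrDr.
Qed.

Lemma cap_translate m a c g :
    (forall s, a [seq (y * g)%g | y <- s] = a s) ->
    (forall s, c [seq (y * g)%g | y <- s] = c s) ->
  forall s, cap m a c [seq (y * g)%g | y <- s] = cap m a c s.
Proof.
move=> ag cg s.
have -> : cap m a c s = cap m (fun t => a [seq (y * g)%g | y <- t]) c s.
  exact: eq_cap.
elim: s {ag} a => //= z [|y s] IH a; last exact: IH.
rewrite -(sum_seq_translate _ _ g) /=; apply: eq_sum_seq => t.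
by rewrite -(cg (z :: t)).
Qed.

(** The Leibniz rule: in the summed entries, adjointness trades a boundary on [a] for a coboundary
    on [h]. *)
Lemma bdry_cap m a h s : s != [::] ->
  bdry (cap m a h) s
  = cap m (bdry a) h s + (-1) ^+ size s * cap m.+1 a (cobdry h) s.
Proof.
elim: s a => // z [|y s] IH a _.
  rewrite bdry_cons bdry_nil expr1 mulN1r.
  (* The subtracted sum reappears in the expansion of [cap m (bdry a) h [:: z]], and the two
     cancel. *)
  have -> : cap m.+1 a (cobdry h) [:: z]
      = \sum_x cap m (fun t => a (z :: t)) h [:: x]
        - sum_seq m (fun t => bdry (fun u => a (z :: u)) t * h (z :: t)).
    rewrite -sum_seq_adjoint -[cap m.+1 _ _ _]/(sum_seq m.+1 _).
    rewrite -[X in X - _]/(sum_seq m.+1 (fun t => a (z :: t) * h t)).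
    rewrite -sum_seqN -sum_seqD; apply: eq_sum_seq => t.
    by rewrite cobdry_cons mulrBr.
  have -> : cap m (bdry a) h [:: z]
      = \sum_x cap m a h [:: x; z]
        - sum_seq m (fun t => bdry (fun u => a (z :: u)) t * h (z :: t)).
    rewrite -sum_seq_sum -sum_seqN -sum_seqD; apply: eq_sum_seq => t.
    by rewrite bdry_cons mulrBl; congr (_ - _); rewrite mulr_suml.
  by rewrite /=; ring.
(* The size condition of [eq_bdry] excludes the empty tail, the only one on which [cap] does not
   recurse. *)
rewrite bdry_cons (@eq_bdry _ (cap m (fun t => a (z :: t)) h)); last by case.
rewrite (IH (fun t => a (z :: t))) //.
rewrite -[cap m (bdry a) h [:: z, y & s]]/(cap m (fun t => bdry a (z :: t)) h (y :: s)).
rewrite (@eq_cap m (fun t => bdry a (z :: t)) _ h h _ (bdry_cons a z)) //.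
rewrite capDl capNl cap_suml.
have -> : (-1) ^+ size [:: z, y & s] = - (-1) ^+ size (y :: s) :> k.
  by rewrite [LHS]exprS mulN1r.
by rewrite mulNr opprD addrA.
Qed.

(** The right side is the formula of [tate_cup] in degrees [Negz i] and [m] with [m <= i]. *)
Lemma cap_cat m a c s : s != [::] ->
  cap m a (c \o rev) s
  = \sum_(t : m.-tuple gT) a (s ++ t) * c (rev t ++ drop (size s).-1 s).
Proof.
move=> s0.
rewrite (sum_tuple m (fun t => a (s ++ t) * c (rev t ++ drop (size s).-1 s))).
elim: s a s0 => // z [|y s] IH a _ /=; last exact: (IH (fun t => a (z :: t))).
by apply: eq_sum_seq => t; rewrite /= rev_cons cats1.
Qed.

(** Reversal exchanges the faces [i] and [n - 1 - i] of an [n]-tuple, and signs are trivial in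
    characteristic 2. *)
Lemma cobdry_rev f s : 2%N \in [pchar k] -> cobdry (f \o rev) s = cobdry f (rev s).
Proof.
move=> k2; rewrite /cobdry /diff size_rev (reindex_inj rev_ord_inj) /=.
apply: eq_bigr => i _; rewrite !(oppr_pchar2 k2) !expr1n !scale1r /=; congr f.
by rewrite /face take_rev drop_rev rev_cat subnSK.
Qed.

End Sequences.

(** * The Klein four group and alternating sums *)

Notation V4 := ('Z_2 * 'Z_2)%type.

Section KleinFour.
Variable k : fieldType.
Hypothesis k2 : 2%N \in [pchar k].
Implicit Types (a f h : seq V4 -> k) (s t : seq V4) (b : 'Z_2).

Definition gH : V4 := (1, 0).
Definition gK : V4 := (0, 1).
Definition retr (x : V4) : V4 := (x.1, 0).

Definition fixed_by (g : V4) f := forall s, f [seq (y * g)%g | y <- s] = f s.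

Lemma retrH x : retr (x * gH)%g = (retr x * gH)%g.
Proof. by rewrite /retr /=; congr (_, _); rewrite [RHS]addr0. Qed.

Lemma retrK x : retr (x * gK)%g = retr x.
Proof. by rewrite /retr /=; congr (_, _); rewrite [LHS]addr0. Qed.

Lemma Z2_add1K b : b + 1 + 1 = b.
Proof. by apply/eqP; case: b => [[|[|]]]. Qed.

Lemma sum_Z2 (F : 'Z_2 -> k) b : \sum_c F c = F b + F (b + 1).
Proof.
rewrite big_ord_recl big_ord1.
have [-> | ->] : b = ord0 \/ b = lift ord0 ord0.
  by case: b => [[|[|]]] // i; [left|right]; apply: val_inj.
- by congr (_ + F _); apply: val_inj.
- by rewrite addrC; congr (_ + F _); apply: val_inj.
Qed.

Lemma sum_V4 (F : V4 -> k) b : \sum_x F x = \sum_c F (b, c) + \sum_c F (b + 1, c).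
Proof.
by rewrite -(sum_Z2 (fun d => \sum_c F (d, c))) pair_bigA; apply: eq_bigr => -[].
Qed.

Lemma sum_fixedH (F : V4 -> k) : (forall x, F (x * gH)%g = F x) -> \sum_x F x = 0.
Proof.
move=> FH; rewrite (sum_V4 _ 0) [X in _ + X](eq_bigr (fun c => F (0, c))).
  exact: addrr_pchar2.
move=> c _; rewrite -(FH (0, c)); congr (F (_, _)); exact/esym/addr0.
Qed.

(* The functional detecting H_(q-1)(H, k); b is the first entry of the
   alternating q-tuple of H. *)
Fixpoint alt_sum q b f : k :=
  if q is q'.+1 then \sum_c alt_sum q' (b + 1) (fun s => f ((b, c) :: s))
  else f [::].

Lemma eq_alt_sum q b f h :
  (forall s, size s = q -> f s = h s) -> alt_sum q b f = alt_sum q b h.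
Proof.
elim: q b f h => [|q IH] b f h e /=; first exact: e.
by apply: eq_bigr => c _; apply: IH => s sq; apply: e; rewrite /= sq.
Qed.

Lemma alt_sumB q b f h :
  alt_sum q b (fun s => f s - h s) = alt_sum q b f - alt_sum q b h.
Proof.
elim: q b f h => //= q IH b f h.
by under eq_bigr do rewrite IH; rewrite sumrB.
Qed.

Lemma alt_sum_sum (I : finType) q b (F : I -> seq V4 -> k) :
  alt_sum q b (fun s => \sum_i F i s) = \sum_i alt_sum q b (F i).
Proof.
elim: q b F => //= q IH b F.
by under eq_bigr do rewrite (IH _ (fun i s => F i (_ :: s))); rewrite exchange_big.
Qed.

Lemma alt_sumZ q b u f : alt_sum q b (fun s => u * f s) = u * alt_sum q b f.
Proof.
elim: q b f => //= q IH b f.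
by under eq_bigr do rewrite IH; rewrite mulr_sumr.
Qed.

Lemma alt_sum_mapK q b f :
  alt_sum q b (fun s => f [seq (y * gK)%g | y <- s]) = alt_sum q b f.
Proof.
elim: q b f => //= q IH b f.
rewrite [RHS](reindex_inj (addIr 1)) /=; apply: eq_bigr => c _.
rewrite -[RHS]IH; apply: eq_alt_sum => s _; congr (f ((_, _) :: _)).
exact: addr0.
Qed.

Lemma alt_sum_mapH q b f :
  alt_sum q b (fun s => f [seq (y * gH)%g | y <- s]) = alt_sum q (b + 1) f.
Proof.
elim: q b f => //= q IH b f; apply: eq_bigr => c _.
rewrite -[RHS]IH; apply: eq_alt_sum => s _; congr (f ((_, _) :: _)).
exact: addr0.
Qed.

(** [gK] pairs off the tuples by the second component of their first entry, so at least one entry is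
    required. *)
Lemma alt_sum_fixedK q b f : fixed_by gK f -> alt_sum q.+1 b f = 0.
Proof.
move=> fK; rewrite /= (sum_Z2 _ 0) -[X in X + _]alt_sum_mapK.
rewrite (@eq_alt_sum _ _ _ (fun s => f ((b, 0 + 1) :: s))) ?(addrr_pchar2 k2) //.
move=> s _; rewrite -(fK ((b, 0 + 1) :: s)); congr (f ((_, _) :: _)).
  by rewrite [RHS]addr0.
by rewrite [RHS]Z2_add1K.
Qed.

(** An insertion that repeats an H-component arises twice, before and after the entry it repeats,
    and cancels. What survives extends the alternation at the end (start [b]) or in front (start
    [b + 1]). *)
Lemma alt_sum_bdry q b f :
  alt_sum q b (bdry f) = alt_sum q.+1 b f + alt_sum q.+1 (b + 1) f.
Proof.
elim: q b f => [|q IH] b f; first by rewrite /= bdry_nil (sum_V4 _ b).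
have -> : alt_sum q.+1 b (bdry f)
    = \sum_c alt_sum q (b + 1) (fun s => \sum_x f [:: x, (b, c) & s])
      - \sum_c alt_sum q (b + 1) (bdry (fun s => f ((b, c) :: s))).
  rewrite -sumrB; apply: eq_bigr => c _; rewrite -alt_sumB.
  by apply: eq_alt_sum => s _; rewrite bdry_cons.
under [X in _ - X]eq_bigr do rewrite IH.
have dupE d : alt_sum q (b + 1) (fun s => \sum_x f [:: x, (b, d) & s])
    = \sum_e alt_sum q (b + 1) (fun s => f [:: (b, e), (b, d) & s])
      + \sum_e alt_sum q (b + 1) (fun s => f [:: (b + 1, e), (b, d) & s]).
  rewrite -(sum_V4 (fun x => alt_sum q (b + 1) (fun s => f [:: x, (b, d) & s]))).
  exact: (alt_sum_sum _ _ (fun x s => f [:: x, (b, d) & s])).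
rewrite (eq_bigr _ (fun d _ => dupE d)).
(* Exchanging the two entries over [b] matches the repetitions made in front with those that the
   induction hypothesis yields after [(b, c)]. *)
rewrite !big_split /= Z2_add1K exchange_big [X in _ + X - _]exchange_big /=.
by rewrite (oppr_pchar2 k2) addrCA addrAC (addrr_pchar2 k2) add0r.
Qed.

(** [gH] exchanges the two starting values, so the two surviving sums are equal. *)
Lemma alt_sum_bdry_fixedH q b f : fixed_by gH f -> alt_sum q b (bdry f) = 0.
Proof.
move=> fH; rewrite alt_sum_bdry -alt_sum_mapH.
by rewrite (@eq_alt_sum _ _ _ f) ?(addrr_pchar2 k2).
Qed.

(** Serves products of two negative degrees, which are joins of tuples; the second part starts where
    the alternation has arrived after [p] entries. *)
Lemma alt_sum_join p q b a f :
  alt_sum (p + q) b (fun s => a (take p s) * f (drop p s))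
  = alt_sum p b a * alt_sum q (b + p%:R) f.
Proof.
elim: p b a => [|p IH] b a.
  rewrite addr0 -alt_sumZ; apply: eq_alt_sum => s _; by rewrite take0 drop0.
rewrite /= mulr_suml; apply: eq_bigr => c _.
by rewrite (IH _ (fun s => a ((b, c) :: s))) -addrA -mulrS.
Qed.

Lemma alt_sum_cap q b m a f :
    fixed_by gH a -> fixed_by gK a -> (forall s, bdry a s = 0) ->
    fixed_by gH f -> (forall s, cobdry f s = 0) ->
  alt_sum q.+1 b (cap m a f) = 0.
Proof.
move=> aH aK a0 fH f0.
have -> : alt_sum q.+1 b (cap m a f)
    = alt_sum q.+1 b (cap m a (fun s => f (map retr s)))
      - alt_sum q.+1 b (cap m a (cobdry (prism retr f))).
  rewrite -alt_sumB; apply: eq_alt_sum => s _.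
  apply/esym/eqP; rewrite subr_eq -capDr; apply/eqP; apply: eq_cap => // t.
  have := prism_homotopy retr f t.
  rewrite (@eq_prism _ _ _ (cobdry f) (fun=> 0)) // (_ : prism _ (fun=> 0) t = 0).
    by rewrite addr0 => ->; rewrite addrC subrK.
  by elim: t => //= x t ->; rewrite subr0.
(* The pullback along [retr] is invariant under translating single entries by [gK], hence its cap
   with [a] is K-invariant. *)
rewrite alt_sum_fixedK ?sub0r; last first.
  apply: cap_translate => // s; rewrite -map_comp; congr f.
  by apply: eq_map => x; apply: retrK.
(* For [m = 0] the coboundary is only evaluated on one-entry tuples, where it is [prism retr f [::]
   = 0]. *)
case: m => [|m].
  rewrite (@eq_alt_sum _ _ _ (fun s => 0 * cap 0 a f s)) ?alt_sumZ ?mul0r ?oppr0 //.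
  move=> s _; rewrite mul0r.
  elim: s {a0 aH aK} a => // z [|y s] IH a; last exact: IH.
  by rewrite /= cobdry_cons cobdry_nil subr0 mulr0.
(* Multiplying by the Leibniz sign turns the sum into that of a boundary; the prism is H-invariant
   because [retr] commutes with [gH]. *)
apply/eqP; rewrite oppr_eq0 -(@mulrI_eq0 _ ((-1) ^+ q.+1)); last first.
  by apply: mulrI; rewrite unitrX // unitrN1.
rewrite -alt_sumZ (@eq_alt_sum _ _ _ (bdry (cap m a (prism retr f)))).
  apply/eqP/alt_sum_bdry_fixedH; apply: cap_translate => // s.
  exact: (prism_translate retrH).
case=> // x s sq; rewrite bdry_cap // sq.
by rewrite (@eq_cap _ _ _ (bdry a) (fun=> 0) _ (prism retr f)) // cap0l add0r.
Qed.

End KleinFour.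

(** * The permutation module and its support variety *)

Section PermutationModule.
Variable k : fieldType.

(** G acts through G/H: the point 0 is fixed, and 1 and 2 are the cosets of H. *)
Definition swap (x : V4) : {perm 'I_3} := (tperm (1%R : 'I_3) 2%R ^+ (x.2 : nat))%g.

Lemma swapM x y : swap (x * y)%g = (swap x * swap y)%g.
Proof.
rewrite /swap -expgD; apply: (@expg_mod _ 2); exact: tperm2.
Qed.

Lemma swap_gH x : swap (x * gH)%g = swap x.
Proof. by congr (_ ^+ nat_of_ord _)%g; apply: addr0. Qed.

Lemma swap0 x : swap x 0 = 0.
Proof. by apply: permX_fix; rewrite tpermD. Qed.

Lemma swap_repr : mx_repr [set: V4] (fun x => perm_mx (swap x) : 'M[k]_3).
Proof.
split=> [|x y _ _]; last by rewrite swapM perm_mxM.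
by rewrite /swap expg0 perm_mx1.
Qed.

(* The direct sum of the trivial module and k[G/H], for H = <gH>. *)
Definition swap_rep : mx_representation k [set: V4]%G 3 :=
  MxRepresentation swap_repr.

Lemma mulmx_perm m n (s : {perm 'I_n}) (A : 'M[k]_(m, n)) i j :
  (A *m perm_mx s) i j = A i (s^-1%g j).
Proof. by rewrite -[s in LHS]invgK -col_permE mxE. Qed.

Lemma coboundary_ext_annihilator :
  (ext_annihilator swap_rep `<=` @coboundary k V4 k^o triv_act)%classic.
Proof.
move=> z [[zc _] zann].
(* The identity of M as a cocycle of degree 0. Its product with [z] bounds some [h], and since G
   fixes the point 0, the [(0, 0)] entry of [h] is a cochain with coboundary [z]. *)
pose one (s : seq V4) : 'M[k]_3 := if size s == 1%N then 1%:M else 0.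
have one_cocycle : cocycle (end_act swap_rep) one.
  split; first split=> //.
  - move=> x s; rewrite /one size_map /end_act; case: ifP => _.
      by rewrite mulmx1 -repr_mxM ?inE // mulVg repr_mx1.
    by rewrite mulmx0 mul0mx.
  - by exists 1%N => s; rewrite /one; case: eqP => // ->.
  apply/funext => s; rewrite /diff /one.
  under eq_bigr => i _.
    rewrite (_ : size (face i s) = (size s).-1); last first.
      rewrite size_cat size_take size_drop ltn_ord; have := ltn_ord i; lia.
    over.
  case: s => [|x [|y [|w s]]] /=; rewrite ?big_ord0 //.
  - by rewrite big1 // => i _; rewrite scaler0.
  - by rewrite big_ord_recl big_ord1 /= scale1r expr1 scaleN1r subrr.
  - by rewrite big1 // => i _; rewrite scaler0.
have [h [h0 heq [N hN]] hE] := zann one one_cocycle.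
exists (fun s => h s 0 0).
  split; first by rewrite h0 mxE.
    move=> x s; rewrite heq /end_act /triv_act /= mulmx_perm -row_permE mxE swap0.
    by congr (h s _ _); apply: (@perm_inj _ (swap x)); rewrite permKV swap0.
  by exists N => s /hN ->; rewrite mxE.
apply/funext => s; transitivity (diff h s 0 0).
  by rewrite /diff summxE; apply: eq_bigr => i _; rewrite mxE.
rewrite hE /cup summxE; case/lastP: s => [|s x].
  by rewrite big_ord0; case: zc.
(* Only the last summand pairs [z] on the whole tuple with [one] on a single entry. *)
rewrite size_rcons big_ord_recr /= big1 ?add0r => [|i _].
  rewrite take_oversize ?size_rcons // drop_rcons // drop_size /one /=.
  by rewrite !mxE mulr1.
rewrite /one size_drop size_rcons; case: eqP => [|_]; last by rewrite !mxE mulr0.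
by have := ltn_ord i; lia.
Qed.

Lemma support_variety_swap_rep :
  support_variety swap_rep = max_ideal_spectrum k V4.
Proof.
apply/seteqP; split=> [I [] //|I Imax]; split=> //.
case: Imax => -[bI _ _ _] _ _.
by move=> z /coboundary_ext_annihilator /bI.
Qed.

(** * Failure of finite generation in Tate cohomology *)

Hypothesis k2 : 2%N \in [pchar k].

(** H is the stabilizer of the point 1. *)
Definition coord1 (f : seq V4 -> 'rV[k]_3) s : k := f s 0 1.

Lemma bdry_coord1 f s : bdry (coord1 f) s = coord1 (tate_diff (Negz 1) f) s.
Proof.
rewrite /coord1 /= summxE; apply: eq_bigr => x _.
by rewrite summxE; apply: eq_bigr => i _; rewrite mxE.
Qed.

Lemma cobdry_coord1 f s : cobdry (coord1 f) s = coord1 (diff f) s.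
Proof. by rewrite /coord1 summxE; apply: eq_bigr => i _; rewrite mxE. Qed.

Lemma coord1_fixedH f :
  equivariant (mod_act swap_rep) f -> fixed_by gH (coord1 f).
Proof.
move=> fE s; rewrite /coord1 fE /mod_act /= mulmx_perm.
by rewrite /swap expg0 invg1 perm1.
Qed.

Lemma alt_sum_tate_cup N i (e : int) b (a : seq V4 -> k) x :
    (0 < N)%N -> Negz N - e = Negz i ->
    @tate_cocycle k V4 k^o triv_act (Negz i) a ->
    tate_cocycle (mod_act swap_rep) e x ->
  alt_sum N.+1 b (coord1 (tate_cup (Negz i) e a x)) = 0.
Proof.
move=> N0 Ne [[aE _] a0] [[xE _] x0].
have aK : fixed_by gK a by move=> s; apply: aE.
have aH : fixed_by gH a by move=> s; apply: aE.
case: e Ne x0 => j Ne x0; last first.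
  have -> : N.+1 = (i.+1 + j.+1)%N by lia.
  rewrite (@eq_alt_sum _ _ _ _ (fun s => a (take i.+1 s) * coord1 x (drop i.+1 s))).
    by rewrite (alt_sum_join i.+1 j.+1 b a) (alt_sum_fixedK k2) // mul0r.
  by move=> s _; rewrite /coord1 mxE.
have ij : (j < i.+1)%N by lia.
rewrite (@eq_alt_sum _ _ _ _ (cap j a (coord1 x \o rev))).
  apply: (alt_sum_cap k2) => //.
  (* [0 < N] excludes [i = 0], where the differential of [a] would be the norm map instead of
     [bdry]. *)
  - by case: i {Ne ij} a0 Ne => [|i] a0 Ne s; [lia | rewrite [LHS](congr1 (@^~ s) a0)].
  - by move=> s; rewrite /= -map_rev coord1_fixedH.
  - by move=> s; rewrite cobdry_rev // cobdry_coord1 /coord1 [diff x]x0 mxE.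
move=> s sN; rewrite cap_cat; last by case: s sN.
rewrite /coord1 /= ij summxE; apply: eq_bigr => t _.
by rewrite mxE.
Qed.

(* The second coordinate is the indicator function of H^N. *)
Definition const_chain N s : 'rV[k]_3 :=
  \row_j ((size s == N) && all (fun g => swap g 1 == j) s)%:R.

(** The defining condition sees entries only modulo H, so the sum over an inserted entry consists of
    equal pairs. *)
Lemma const_chain_cocycle N :
  tate_cocycle (mod_act swap_rep) (Negz N.+1) (const_chain N.+2).
Proof.
split; first split.
- move=> x s; apply/rowP => j; rewrite /mod_act mulmx_perm !mxE size_map all_map.
  congr (nat_of_bool (_ && _))%:R; apply: eq_all => g /=.
  by rewrite swapM permM -(inj_eq (@perm_inj _ (swap x)^-1)) permK.
- by move=> s /= /negPf sN; apply/rowP => j; rewrite !mxE sN.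
apply/funext => s; apply/rowP => j; rewrite [RHS]mxE summxE.
apply: (sum_fixedH k2) => x; rewrite !summxE; apply: eq_bigr => i _.
by rewrite !mxE !size_cat /= !all_cat /= swap_gH.
Qed.

(** Exactly one tuple of the alternating sum has all its entries in H. *)
Lemma alt_sum_const_chain N b : alt_sum N b (coord1 (const_chain N)) = 1.
Proof.
rewrite (@eq_alt_sum _ _ _ _ (fun s => (all (fun g => swap g 1 == 1) s)%:R)).
  elim: N b => //= N IH b; rewrite (sum_Z2 _ 0) -[RHS]addr0; congr (_ + _).
    rewrite -[RHS](IH (b + 1)); apply: eq_alt_sum => s _.
    by rewrite /swap expg0 perm1 eqxx.
  rewrite (@eq_alt_sum _ _ _ _ (fun=> 0 * 0)) ?alt_sumZ ?mul0r // => s _.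
  by rewrite /swap expg1 tpermL.
by move=> s sN; rewrite /coord1 mxE sN eqxx.
Qed.

Lemma not_tate_finitely_generated_swap_rep : ~ tate_finitely_generated swap_rep.
Proof.
(* The test class has degree [-(N + 2)], so each coefficient [a i] has degree at most -2. *)
move=> [r [e [x [xz gen]]]]; pose N := (\sum_i `|e i|)%N.
have eN i : (`|e i| <= N)%N by rewrite /N (bigD1 i) //= leq_addr.
have [a [az [h hc hy]]] := gen _ _ (const_chain_cocycle N).
have n1 : Negz N.+1 - 1 = Negz N.+2 by lia.
rewrite n1 in hc hy; have [hE _] := hc.
suff : alt_sum N.+2 0 (coord1 (const_chain N.+2)) = 0.
  by rewrite alt_sum_const_chain; apply/eqP/oner_neq0.
pose ax i : seq V4 -> 'rV[k]_3 := tate_cup (Negz N.+1 - e i) (e i) (a i) (x i).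
(* The double sign makes the sum a difference, as [alt_sumB] requires. *)
rewrite (@eq_alt_sum _ _ _ _ (fun s => \sum_(i < r) coord1 (ax i) s
   - - bdry (coord1 h) s)); last first.
  move=> s _; rewrite bdry_coord1 /coord1 opprK.
  have -> : tate_diff (Negz 1) h = const_chain N.+2 - \sum_i ax i by exact: hy.
  rewrite fct_sumE -[(_ - _) s]/(const_chain N.+2 s - \sum_i ax i s).
  by rewrite !mxE summxE subrKC.
rewrite (alt_sumB _ _ (fun s => \sum_(i < r) coord1 (ax i) s)) alt_sum_sum big1.
  rewrite (@eq_alt_sum _ _ _ _ (fun s => -1 * bdry (coord1 h) s)) ?alt_sumZ.
    by rewrite (alt_sum_bdry_fixedH k2) ?mulr0 ?subr0 //; apply: coord1_fixedH.
  by move=> s _; rewrite mulN1r.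
move=> i _; have := az i; rewrite /ax.
have [j nE] : exists j, Negz N.+1 - e i = Negz j.
  case jE: (Negz N.+1 - e i) => [j|j]; last by exists j.
  by have := eN i; lia.
by rewrite nE => aj; apply: (alt_sum_tate_cup _ _ nE).
Qed.

End PermutationModule.

Theorem proposition3p12 :
  exists (p : nat) (k : fieldType) (gT : finGroupType) (m : nat)
         (rG : mx_representation k [set: gT]%G m),
    [/\ prime p, p \in [pchar k],
        support_variety rG = max_ideal_spectrum k gT
      & ~ tate_finitely_generated rG].
Proof.
have k2 : 2%N \in [pchar 'F_2] by rewrite pchar_Fp.
exists 2, 'F_2, V4, 3, (swap_rep 'F_2); split=> //.
- exact: support_variety_swap_rep.
- exact: not_tate_finitely_generated_swap_rep.
Qed.
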